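(* (i) Any $\sigma(\mathcal{P},C_b)$-lower semicontinuous and quasi-convex functional $\Phi:\mathcal{P}(\mathbb{R})\to\mathbb{R}\cup\{+\infty\}$ can be represented as $$\Phi(P)=\sup_{f\in C_b}R\left(\int f\,dP,f\right),\qquad P\in\mathcal{P}(\mathbb{R}),$$ where $R:\mathbb{R}\times C_b\to\overline{\mathbb{R}}$ is defined by $$R(t,f):=\inf_{Q\in\mathcal{P}}\left\{\Phi(Q)\ \Big|\ \int f\,dQ\ge t\right\}.$$ (ii) If in addition $\Phi$ is monotone (i.e. $P\preccurlyeq Q$ implies $\Phi(P)\ge\Phi(Q)$), then the representation holds with $C_b$ replaced by $C_b^-$: $$\Phi(P)=\sup_{f\in C_b^-}R\left(\int f\,dP,f\right),\qquad P\in\mathcal{P}(\mathbb{R}).$$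
   Context: $\mathcal{P}=\mathcal{P}(\mathbb{R})$ is the set of Borel probability measures on $\mathbb{R}$, $F_P(x)=P(-\infty,x]$, and $Q\preccurlyeq P$ iff $F_P(x)\le F_Q(x)$ for all $x\in\mathbb{R}$. $C_b$ is the space of bounded continuous functions $f:\mathbb{R}\to\mathbb{R}$ and $C_b^-=\{f\in C_b\mid f\text{ is decreasing}\}$ (decreasing in the weak sense). $\sigma(\mathcal{P},C_b)$ is the topology of weak convergence. $\Phi$ is quasi-convex if $\Phi(\lambda P+(1-\lambda)Q)\le\Phi(P)\vee\Phi(Q)$ for all $P,Q\in\mathcal{P}$, $\lambda\in[0,1]$. Convention: $\inf\emptyset=+\infty$. *)

(* Defs.v *)
From HB Require Import structures.
From mathcomp Require Import all_boot all_order all_algebra.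
From mathcomp Require Import all_classical all_reals all_analysis.
Import Order.TTheory GRing.Theory Num.Theory.
Import numFieldNormedType.Exports.

Set Implicit Arguments.
Unset Strict Implicit.
Unset Printing Implicit Defensive.

Local Open Scope classical_set_scope.
Local Open Scope ring_scope.

(* [measurableTypeR R] carries the Borel sigma-algebra. An element of
   [probability _ R] is a function on all sets, so two of them may agree on
   Borel sets without being equal; integrals do not distinguish them, nor do
   functionals that are lower semicontinuous for the topology below. *)
Definition borel_prob (R : realType) := probability (measurableTypeR R) R.

Definition Cb (R : realType) : set (R -> R) :=
  [set f | continuous f /\ bounded_fun f].

Definition Cb_dec (R : realType) : set (R -> R) :=
  [set f | Cb f /\ nonincreasing_fun f].

Definition mean (R : realType) (f : R -> R) (P : borel_prob R) : R :=
  \int[P]_x f x.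

(* Copy of [borel_prob R] carrying the topology of weak convergence: the
   coarsest one making [mean f] continuous for every [f] in [Cb R]. *)
Definition weak_prob (R : realType) : Type := borel_prob R.

HB.instance Definition _ (R : realType) :=
  Topological.copy (weak_prob R)
    (@sup_topology (borel_prob R) {f : R -> R | Cb f}
      (fun f => Topological.class (initial_topology (mean (projT1 f))))).

Section mixture.
(* l P + (1 - l) Q, for l in [0, 1] *)
Context (R : realType) (l : {i01 R}) (P Q : borel_prob R).

Definition mixture : set (measurableTypeR R) -> \bar R :=
  measure_add (mscale l%:num%:nng P) (mscale (1 - l%:num)%:nng Q).

HB.instance Definition _ := Measure.on mixture.

Let mixture_setT : mixture setT = 1%E.
Proof.
rewrite /mixture measure_addE/= /mscale/=.
rewrite !(@probability_setT _ (measurableTypeR R)) !mule1.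
by rewrite -EFinD subrKC.
Qed.

HB.instance Definition _ :=
  Measure_isProbability.Build _ _ _ mixture mixture_setT.

End mixture.

(* Stochastic dominance by cumulative distribution functions, F_P <= F_Q: [P]
   puts its mass further to the right than [Q]. *)
Definition stoch_le (R : realType) (Q P : borel_prob R) : Prop :=
  forall x : R, (P `]-oo, x]%classic <= Q `]-oo, x]%classic)%E.

Definition quasi_convex (R : realType) (Phi : borel_prob R -> \bar R) : Prop :=
  forall (P Q : borel_prob R) (l : {i01 R}),
    (Phi (mixture l P Q) <= maxe (Phi P) (Phi Q))%E.

Definition stoch_monotone (R : realType) (Phi : borel_prob R -> \bar R) : Prop :=
  forall P Q : borel_prob R, stoch_le P Q -> (Phi Q <= Phi P)%E.

(* [ereal_inf set0 = +oo] *)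
Definition inf_risk (R : realType) (Phi : borel_prob R -> \bar R)
    (t : R) (f : R -> R) : \bar R :=
  ereal_inf [set Phi Q | Q in [set Q : borel_prob R | t <= mean f Q]].

(* Main.v *)
(* If a < Phi(P), the sublevel set {Phi <= a} is convex, and by lower
   semicontinuity a weak neighbourhood of P, given by finitely many test
   functions f_i, misses it. The vectors (mean f_i Q - mean f_i P)_i, for Q in
   the sublevel set, then form a bounded convex subset of a Euclidean space at
   positive distance from 0. An almost shortest vector of that set separates it
   from 0 with a gap, and the corresponding combination f of the f_i separates
   P from the sublevel set. No compactness is needed.

   For monotone Phi, replace f by g(x) = sup_{y >= x} f(y), which is continuous,
   decreasing and at least f. Moving each x to a point T(x) >= x with f(T(x))
   close to g(x) turns Q into a dominating Q', still in the sublevel set, with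
   mean f Q' close to mean g Q. So the gap survives with g in place of f. *)
Require Import Defs.
From mathcomp Require Import all_boot all_order all_algebra.
From mathcomp Require Import all_classical all_reals all_analysis.
From mathcomp Require Import measurable_realfun.
From mathcomp Require Import ring lra.
Import Order.TTheory GRing.Theory Num.Theory.
Import numFieldNormedType.Exports.

Set Implicit Arguments.
Unset Strict Implicit.
Unset Printing Implicit Defensive.

Local Open Scope classical_set_scope.
Local Open Scope ring_scope.

(** * Separation of a bounded convex set from the origin *)

Lemma convex_image_separation (R : realType) (I : eqType) (s : seq I)
    (T : Type) (v : T -> I -> R) (A : set T) (M : I -> R) (e : R) :
  (forall x y l, A x -> A y -> 0 <= l <= 1 ->
    exists2 z, A z & {in s, forall i, v z i = l * v x i + (1 - l) * v y i}) ->
  (forall x, A x -> {in s, forall i, `|v x i| <= M i}) ->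
  0 < e ->
  (forall x, A x -> exists2 i, i \in s & e <= `|v x i|) ->
  exists c : I -> R, exists2 g, 0 < g &
    forall x, A x -> g <= \sum_(i <- s) c i * v x i.
Proof.
move=> Aconv AM e0 Ae.
have [->|/set0P[x0 Ax0]] := eqVneq A set0.
  by exists (fun=> 0), 1.
pose dot x y := \sum_(i <- s) v x i * v y i.
have dot_ge x : A x -> e ^+ 2 <= dot x x.
  move=> Ax; have [i si ei] := Ae x Ax.
  have -> : dot x x = v x i * v x i + \sum_(j <- rem i s) v x j * v x j.
    by rewrite /dot (big_rem _ si).
  rewrite -[leLHS]addr0 lerD//; last first.
    by apply: sumr_ge0 => j _; rewrite -expr2 sqr_ge0.
  by rewrite -expr2 -(real_normK (num_real (v x i))) lerXn2r ?nnegrE// ltW.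
pose B := \sum_(i <- s) M i ^+ 2.
have dot_le x : A x -> dot x x <= B.
  move=> Ax; rewrite /dot /B !big_seq; apply: ler_sum => i si.
  rewrite -expr2 -(real_normK (num_real (v x i))) lerXn2r ?nnegrE//.
    by rewrite (le_trans _ (AM x Ax i si)).
  exact: AM.
pose E := [set dot x x | x in A].
have E0 : E !=set0 by exists (dot x0 x0), x0.
have Elb : has_lbound E by exists (e ^+ 2) => _ [x Ax <-]; exact: dot_ge.
set d := inf E.
have d_gt0 : 0 < d.
  rewrite (@lt_le_trans _ _ (e ^+ 2)) ?exprn_gt0//.
  by apply: lb_le_inf => // _ [x Ax <-]; exact: dot_ge.
have d_le x : A x -> d <= dot x x by move=> Ax; apply: ge_inf => //; exists x.
have dB : d <= B by rewrite (le_trans (d_le x0 Ax0))// dot_le.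
have B0 : 0 < B by exact: lt_le_trans dB.
(* The step length [l] depends on the bound [B] only, so one [y] serves all [x]. With the tolerance
   [l * d / 2] below, [dot y x < d / 2] would give [dot z z < d * (1 - l ^+ 2 + l ^+ 3 / 2) < d]:
   the terms of first order in [l] cancel. *)
have [l [l0 lB l1]] : exists l, [/\ 0 < l, l * B = d / 2 & l <= 1 / 2].
  exists (d / (2 * B)); split; first by rewrite divr_gt0// mulr_gt0.
    by field; rewrite gt_eqF.
  by rewrite ler_pdivrMr ?mulr_gt0//; lra.
have ld0 : 0 < l * d / 2 by rewrite divr_gt0// mulr_gt0.
have [_ [y Ay <-] y_lt] := inf_adherent ld0 (conj E0 Elb).
rewrite -/d in y_lt.
(* y almost minimizes the squared norm over the convex image, so moving a
   proportion l towards any x cannot decrease the norm by much. *)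
exists (v y), (d / 2); first by rewrite divr_gt0.
move=> x Ax; rewrite -/(dot y x) leNgt; apply/negP => xlt.
have [|z Az zE] := Aconv x y l Ax Ay; first by apply/andP; split; lra.
have : dot z z = l ^+ 2 * dot x x + (1 - l) ^+ 2 * dot y y +
    2 * l * (1 - l) * dot y x.
  rewrite /dot !mulr_sumr -!big_split/= !big_seq.
  by apply: eq_bigr => i si; rewrite zE//; ring.
have := d_le z Az; have := dot_le x Ax => xB dz zz.
have : l ^+ 2 * dot x x <= l * (d / 2).
  by rewrite -lB expr2 -mulrA ler_pM2l// ler_pM2l.
have : (1 - l) ^+ 2 * dot y y <= (1 - l) ^+ 2 * (d + l * d / 2).
  by rewrite ler_wpM2l ?sqr_ge0// ltW.
have : 2 * l * (1 - l) * dot y x < 2 * l * (1 - l) * (d / 2).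
  by rewrite ltr_pM2l// mulr_gt0 ?mulr_gt0//; lra.
have : l ^+ 2 * (l * d / 2) <= l * (l * d / 2).
  by rewrite ler_pM2r// expr2 ler_piMr ?ltW//; lra.
have : 0 < l * (l * d / 2) by rewrite mulr_gt0.
lra.
Qed.

(** * Bounded continuous functions and their means *)

Lemma Cb_bound (R : realType) (f : R -> R) :
  Cb f <-> continuous f /\ exists M, forall x, `|f x| <= M.
Proof.
have PF := @globally_properfilter _ setT (0 : R) I.
split=> -[cf bf]; split=> //.
  by have [M fM] := (ex_bound f).1 bf; exists M => x; exact: fM.
by apply/(ex_bound f); have [M fM] := bf; exists M => x _; exact: fM.
Qed.

Lemma Cb_measurable (R : realType) (f : R -> R) :
  Cb f -> measurable_fun [set: R] f.
Proof. by move=> [cf _]; exact: continuous_measurable_fun. Qed.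

Lemma Cb_integrable (R : realType) (f : R -> R) (P : borel_prob R) :
  Cb f -> P.-integrable setT (EFin \o f).
Proof.
move=> Cf; apply: measurable_bounded_integrable => //.
- by apply: le_lt_trans (ltry 1); exact: probability_le1.
- exact: Cb_measurable.
- exact: Cf.2.
Qed.

Lemma mean_mixture (R : realType) (f : R -> R) (l : {i01 R})
    (P Q : borel_prob R) :
  Cb f -> mean f (mixture l P Q) = l%:num * mean f P + (1 - l%:num) * mean f Q.
Proof.
move=> Cf.
have mf : measurable_fun [set: R] (EFin \o f).
  by apply/measurable_EFinP; exact: Cb_measurable.
have mixE (g : R -> \bar R) : measurable_fun [set: R] g ->
    (forall x, 0 <= g x)%E ->
    (\int[mixture l P Q]_x g x = l%:num%:E * \int[P]_x g x +
      (1 - l%:num)%:E * \int[Q]_x g x)%E.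
  move=> mg g0; rewrite /mixture ge0_integral_measure_add//.
  by rewrite !ge0_integral_mscale.
have := Cb_integrable P Cf; have := Cb_integrable Q Cf => iQ iP.
rewrite /mean /Rintegral integralE !mixE;
  do ?[exact: measurable_funepos|exact: measurable_funeneg
      |by move=> x; rewrite ?funepos_ge0 ?funeneg_ge0].
rewrite [in RHS]integralE [X in _ = _ + _ * fine X]integralE.
(* Additivity in the measure was applied to the positive and negative parts; all four integrals are
   finite, so [fine] commutes with the arithmetic. *)
have := integrable_pos_fin_num measurableT iP.
have := integrable_neg_fin_num measurableT iP.
have := integrable_pos_fin_num measurableT iQ.
have := integrable_neg_fin_num measurableT iQ.
move=> /fineK <- /fineK <- /fineK <- /fineK <-.
by rewrite /=; ring.
Qed.

Lemma CbZD (R : realType) (c : R) (f g : R -> R) :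
  Cb f -> Cb g -> Cb (fun x => c * f x + g x).
Proof.
move=> /Cb_bound[cf [M fM]] /Cb_bound[cg [N gN]]; apply/Cb_bound; split.
  by move=> x; apply: cvgD; [apply: cvgM; [exact: cvg_cst|exact: cf]|exact: cg].
exists (`|c| * M + N) => x; rewrite (le_trans (ler_normD _ _))//.
by rewrite lerD// normrM ler_wpM2l.
Qed.

Lemma meanZD (R : realType) (c : R) (f g : R -> R) (P : borel_prob R) :
  Cb f -> Cb g -> mean (fun x => c * f x + g x) P = c * mean f P + mean g P.
Proof.
move=> Cf Cg; have iP := Cb_integrable P.
rewrite /mean RintegralD//; last 2 first.
- have := integrableZl measurableT c (iP _ Cf).
  by apply: eq_integrable => // x _ /=; rewrite EFinM.
- exact: iP.
by rewrite RintegralZl//; exact: iP.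
Qed.

Lemma mean_cst (R : realType) (c : R) (P : borel_prob R) :
  mean (fun=> c) P = c.
Proof.
rewrite /mean Rintegral_cst//.
transitivity (c * fine (1%E : \bar R)); last exact: mulr1.
by congr (_ * fine _); exact: probability_setT.
Qed.

Lemma Cb_cst (R : realType) (c : R) : Cb (fun=> c : R).
Proof. by split; [exact: cst_continuous|exact: bounded_cst]. Qed.

Lemma Cb_sum (R : realType) (I : eqType) (s : seq I) (c : I -> R)
    (F : I -> R -> R) : {in s, forall i, Cb (F i)} ->
  exists2 f, Cb f &
    forall P : borel_prob R, mean f P = \sum_(i <- s) c i * mean (F i) P.
Proof.
elim: s => [_|i s IH sF].
  exists (fun=> 0); first exact: Cb_cst.
  by move=> P; rewrite mean_cst big_nil.
have [|f Cf fE] := IH; first by move=> j js; apply: sF; rewrite in_cons js orbT.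
have Ci : Cb (F i) by apply: sF; rewrite mem_head.
exists (fun x => c i * F i x + f x); first exact: CbZD.
by move=> P; rewrite meanZD// fE big_cons.
Qed.

Lemma le_mean (R : realType) (f g : R -> R) (P : borel_prob R) :
  Cb f -> Cb g -> (forall x, f x <= g x) -> mean f P <= mean g P.
Proof.
move=> Cf Cg fg.
by apply: le_Rintegral => //; exact: Cb_integrable.
Qed.

Lemma norm_mean_le (R : realType) (f : R -> R) (M : R) (P : borel_prob R) :
  Cb f -> (forall x, `|f x| <= M) -> `|mean f P| <= M.
Proof.
move=> Cf fM; rewrite ler_norml; apply/andP; split.
  rewrite -[leLHS](mean_cst _ P); apply: le_mean => // [|x]; first exact: Cb_cst.
  by have := fM x; rewrite ler_norml => /andP[].
rewrite -[leRHS](mean_cst _ P); apply: le_mean => // [|x]; first exact: Cb_cst.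
by have := fM x; rewrite ler_norml => /andP[].
Qed.

(** * Weak neighbourhoods and separation from sublevel sets *)

Lemma weak_nbhs (R : realType) (P : borel_prob R) (V : set (borel_prob R)) :
  nbhs (P : weak_prob R) V ->
  exists (s : seq (R -> R)) (e : R), [/\ 0 < e, {in s, forall f, Cb f} &
    forall Q, {in s, forall f, `|mean f Q - mean f P| < e} -> V Q].
Proof.
(* F is the filter generated by the finite-dimensional cylinders around P. *)
pose F : set_system (borel_prob R) := fun W =>
  exists (s : seq (R -> R)) (e : R), [/\ 0 < e, {in s, forall f, Cb f} &
    forall Q, {in s, forall f, `|mean f Q - mean f P| < e} -> W Q].
have FF : Filter F.
  split.
  - by exists [::], 1; split.
  - move=> A B [s [e [e0 sC sA]]] [t [d [d0 tC tB]]].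
    exists (s ++ t), (Num.min e d); split.
    + by rewrite lt_min e0 d0.
    + by move=> f; rewrite mem_cat => /orP[/sC|/tC].
    + move=> Q stQ; split.
        apply: sA => f fs; have := stQ f.
        by rewrite mem_cat fs lt_min => /(_ isT)/andP[].
      apply: tB => f ft; have := stQ f.
      by rewrite mem_cat ft orbT lt_min => /(_ isT)/andP[].
  - move=> A B AB [s [e [e0 sC sA]]]; exists s, e; split=> // Q sQ.
    by apply: AB; exact: sA.
(* Convergence in a supremum of topologies can be tested on each of them, and there a single test
   function suffices. *)
suff : F --> (P : weak_prob R) by apply.
apply/cvg_sup => -[f Cf] W /=.
rewrite (@nbhsE (initial_topology (mean f))) => -[U [[D oD <-] DP] UW].
have /nbhs_ballP[e /= e0 eD] : nbhs (mean f P) D by exact: open_nbhs_nbhs.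
exists [:: f], e; split => //; first by move=> g; rewrite inE => /eqP ->.
move=> Q /(_ f); rewrite mem_head => /(_ isT) fQ.
by apply: UW; apply: eD; rewrite /ball/= distrC.
Qed.

(** The gap [g] is uniform in [Q] so that the monotone case can spend part of it. *)
Lemma quasi_convex_lsc_separation (R : realType) (Phi : borel_prob R -> \bar R)
    (P : borel_prob R) (a : R) :
  @lower_semicontinuous (weak_prob R) R Phi -> quasi_convex Phi ->
  (a%:E < Phi P)%E ->
  exists2 f, Cb f & exists2 g, 0 < g &
    forall Q, (Phi Q <= a%:E)%E -> mean f Q + g <= mean f P.
Proof.
move=> lsc qc aP; have [V PV Va] := lsc P a aP.
have [s [e [e0 sC sV]]] := weak_nbhs PV.
pose v (Q : borel_prob R) f := mean f Q - mean f P.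
have [M sM] : exists M : (R -> R) -> R, {in s, forall f x, `|f x| <= M f}.
  have /choice[M MP] : forall f, exists M, f \in s -> forall x, `|f x| <= M.
    move=> f; have [fs|_] := boolP (f \in s); last by exists 0.
    by have /Cb_bound[_ [M fM]] := sC f fs; exists M.
  by exists M.
have [|Q Qa|//|Q Qa|c [g g0 cg]] :=
    @convex_image_separation R _ s _ v [set Q | (Phi Q <= a%:E)%E]
      (fun f => M f + M f) e.
- move=> Q Q' l Qa Q'a /andP[l0 l1]; exists (mixture (Itv01 l0 l1) Q Q').
    by rewrite /= (le_trans (qc _ _ _))// ge_max Qa.
  by move=> f /sC Cf; rewrite /v mean_mixture//=; ring.
- move=> f fs; rewrite (le_trans (ler_normB _ _))// lerD//.
    by apply: norm_mean_le; [exact: sC|exact: sM].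
  by apply: norm_mean_le; [exact: sC|exact: sM].
- apply: contrapT => /forall2NP sQ; move: Qa => /=; rewrite leNgt Va//.
  by apply: sV => f fs; have [//|/negP] := sQ f; rewrite -ltNge.
(* The sign flips because [c] is positive on the sublevel set, whereas [f] must have its larger mean
   at [P]. *)
have [f Cf fE] := Cb_sum (fun f => - c f) sC.
exists f => //; exists g => // Q /cg; rewrite !fE => {}cg.
rewrite -lerBrDl -sumrB (le_trans cg)// ler_sum// => h _.
by rewrite /v; lra.
Qed.

(** * The least nonincreasing majorant and transport to the right *)

Definition right_sup (R : realType) (f : R -> R) (x : R) : R :=
  sup [set f y | y in [set y | x <= y]].

Section right_sup.
Context (R : realType) (f : R -> R).
Hypothesis Cf : Cb f.

Let right_sup_bound x : has_sup [set f y | y in [set y | x <= y]].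
Proof.
have /Cb_bound[_ [M fM]] := Cf.
split; first by exists (f x), x => /=.
by exists M => _ [y _ <-]; rewrite (le_trans (ler_norm _)).
Qed.

Lemma le_right_sup x y : x <= y -> f y <= right_sup f x.
Proof. by move=> xy; apply: sup_upper_bound => //; exists y. Qed.

Lemma right_sup_le x c : (forall y, x <= y -> f y <= c) -> right_sup f x <= c.
Proof.
by move=> fc; apply: ge_sup; [case: (right_sup_bound x)|move=> _ [y /fc ? <-]].
Qed.

Lemma right_sup_nonincreasing : nonincreasing_fun (right_sup f).
Proof.
move=> x y xy; apply: right_sup_le => z yz; apply: le_right_sup.
exact: le_trans yz.
Qed.

(** The suprema from [x] and from [y] range over the same points except those between [x] and [y],
    where [f] stays within [e / 2] of [f x]. *)
Lemma Cb_right_sup : Cb (right_sup f).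
Proof.
have /Cb_bound[cf [M fM]] := Cf.
apply/Cb_bound; split; last first.
  exists M => x; rewrite ler_norml; apply/andP; split.
    apply: le_trans (le_right_sup (lexx x)).
    by have := fM x; rewrite ler_norml => /andP[].
  by apply: right_sup_le => y _; rewrite (le_trans (ler_norm _)).
move=> x; apply/cvgrPdist_le => e e0.
have e20 : 0 < e / 2 by rewrite divr_gt0.
have /cvgrPdist_lt/(_ _ e20)/nbhs_ballP[d /= d0 fd] := cf x.
have close y : `|x - y| < d -> `|f x - f y| < e / 2 by move=> xy; exact: fd.
exists d => //= y xy; rewrite ler_distl; apply/andP; split.
  rewrite lerBlDr; apply: right_sup_le => z yz.
  have [xz|zx] := leP x z; first by rewrite (le_trans (le_right_sup xz))// lerDl ltW.
  have : `|f x - f z| < e / 2.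
    apply: close; apply: le_lt_trans xy.
    by rewrite !ger0_norm ?subr_ge0 ?lerB// ltW//; exact: le_lt_trans zx.
  have := le_right_sup (lexx x); rewrite ltr_distl => ? /andP[]; lra.
apply: right_sup_le => z xz.
have [yz|zy] := leP y z; first by rewrite (le_trans (le_right_sup yz))// lerDl ltW.
have := close _ xy.
have : `|f x - f z| < e / 2.
  apply: close; apply: le_lt_trans xy.
  rewrite ![`|x - _|]distrC !ger0_norm ?subr_ge0 ?lerB// ltW//.
  exact: le_lt_trans zy.
have := le_right_sup (lexx y).
by rewrite !ltr_distl => ? /andP[? ?] /andP[? ?]; lra.
Qed.

(* The first point to the right of x where f almost attains its supremum over
   [x, +oo[. This T is automatically nondecreasing, hence measurable. *)
Lemma right_sup_transport (e : R) : 0 < e ->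
  exists T : R -> R, [/\ {homo T : x y / x <= y},
    forall x, x <= T x & forall x, right_sup f x - e <= f (T x)].
Proof.
move=> e0; pose S x := [set y | x <= y /\ right_sup f x - e <= f y].
have S0 x : S x !=set0.
  have [_ [y xy <-] fy] := sup_adherent e0 (right_sup_bound x).
  by exists y; split => //; exact: ltW.
have Slb x : has_lbound (S x) by exists x => y [].
have xS x : x <= inf (S x) by apply: lb_le_inf => // y [].
exists (fun x => inf (S x)); split => //.
- move=> x x' xx'; have [Tx|Tx] := leP (inf (S x)) x'.
    exact: le_trans (xS x').
  (* No point of [x, x'[ lies in [S x], so [f] is below [right_sup f x - e] there and the supremum
     is approached beyond [x']. Hence [S x'] is contained in [S x]. *)
  have gE : right_sup f x <= right_sup f x'.
    rewrite leNgt; apply/negP => gxx'.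
    have : right_sup f x <= Num.max (right_sup f x') (right_sup f x - e).
      apply: right_sup_le => y xy; rewrite le_max.
      have [x'y|yx'] := leP x' y; first by rewrite le_right_sup.
      apply/orP; right; rewrite ltW// ltNge; apply/negP => fy.
      have : inf (S x) <= y by exact: ge_inf.
      by rewrite leNgt (lt_trans yx').
    by rewrite leNgt gt_max gxx' ltrBlDr ltrDl e0.
  apply: lb_le_inf => // y [x'y fy]; apply: ge_inf => //; split.
    exact: le_trans x'y.
  by apply: le_trans fy; rewrite lerD2r.
(* By continuity, a strict failure at [inf (S x)] would persist nearby, where [S x] has points. *)
- move=> x; rewrite leNgt; apply/negP => fT.
  have d0 : 0 < right_sup f x - e - f (inf (S x)) by rewrite subr_gt0.
  have /cvgrPdist_lt/(_ _ d0)/nbhs_ballP[d /= {}d0 fd] := Cf.1 (inf (S x)).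
  have [y Sy yT] := inf_adherent d0 (conj (S0 x) (Slb x)).
  have : `|f (inf (S x)) - f y| < right_sup f x - e - f (inf (S x)).
    apply: fd; rewrite /ball/= distrC ger0_norm ?subr_ge0; last exact: ge_inf.
    by rewrite ltrBlDl.
  by rewrite ltr_distl => /andP[? ?]; case: Sy; lra.
Qed.

End right_sup.

Lemma lte_real_between (R : realFieldType) (x y : \bar R) :
  (x < y)%E -> exists a : R, (x < a%:E < y)%E.
Proof.
case: x y => [x||] [y||]//; rewrite ?lte_fin => xy.
- by exists ((x + y) / 2); rewrite !lte_fin; apply/andP; split; lra.
- by exists (x + 1); rewrite lte_fin ltry ltrDl ltr01.
- by exists (y - 1); rewrite lte_fin ltNyr gtrDl ltrN10.
- by exists 0; rewrite ltNyr ltry.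
Qed.

Lemma stoch_le_transport (R : realType) (f : R -> R) (e : R)
    (Q : borel_prob R) : Cb f -> 0 < e ->
  exists2 Q' : borel_prob R, stoch_le Q Q' &
    mean (right_sup f) Q - e <= mean f Q'.
Proof.
move=> Cf e0; have [T [Thomo Tge fT]] := right_sup_transport Cf e0.
have mT : measurable_fun [set: measurableTypeR R] (T : _ -> measurableTypeR R).
  exact: nondecreasing_measurable.
pose X : {mfun measurableTypeR R >-> measurableTypeR R} := 
  @mfun_Sub _ _ (measurableTypeR R) (measurableTypeR R) T (mem_set mT).
have mf := Cb_measurable Cf.
have mfT : measurable_fun [set: R] (f \o T) by exact: measurableT_comp.
have ifT : Q.-integrable setT (EFin \o (f \o T)).
  apply: measurable_bounded_integrable => //.
    by apply: le_lt_trans (ltry 1); exact: probability_le1.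
  have PF := @globally_properfilter _ setT (0 : R) I.
  have /Cb_bound[_ [M fM]] := Cf.
  by apply/(ex_bound (f \o T)); exists M => x _; exact: fM.
(* As [y <= T y], the event [T y <= x] forces [y <= x]: the image law has the smaller distribution
   function. *)
exists (distribution Q X).
  move=> x; change (Q (T @^-1` `]-oo, x]%classic) <= Q `]-oo, x]%classic)%E.
  have mI : measurable (`]-oo, x]%classic : set R) by exact: measurable_itv.
  apply: le_measure.
  - by rewrite inE; have := mT measurableT _ mI; rewrite setTI.
  - by rewrite inE; exact: mI.
  - by move=> y; rewrite /= !in_itv/=; exact: le_trans.
have Cg := Cb_right_sup Cf.
have -> : mean f (distribution Q X) = \int[Q]_x (f \o T) x.
  congr fine; apply: (integral_distribution (P := Q) (X := X) (f := EFin \o f)).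
    exact/measurable_EFinP.
  exact: ifT.
have -> : mean (right_sup f) Q - e = mean (fun x => 1 * right_sup f x + - e) Q.
  by rewrite meanZD// ?mul1r ?mean_cst//; exact: Cb_cst.
apply: le_Rintegral => //; last by move=> x _; rewrite mul1r; exact: fT.
by apply: Cb_integrable; apply: CbZD => //; exact: Cb_cst.
Qed.

(** * From separation to the dual representation *)

(** One inequality holds for any [D], since [P] competes in its own infimum. For the other, a
    separating [f] excludes every [Q] with [Phi Q <= a] from the infimum, which is therefore at
    least [a]. *)
Lemma dual_representation (R : realType) (Phi : borel_prob R -> \bar R)
    (D : set (R -> R)) (P : borel_prob R) :
  (forall a, (a%:E < Phi P)%E ->
    exists2 f, D f & forall Q, (Phi Q <= a%:E)%E -> mean f Q < mean f P) ->
  Phi P = ereal_sup [set inf_risk Phi (mean f P) f | f in D].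
Proof.
move=> sep; apply/eqP; rewrite eq_le; apply/andP; split; last first.
  apply: ge_ereal_sup => _ [f _ <-]; apply: ereal_inf_lbound.
  by exists P => //=.
rewrite leNgt; apply/negP => /lte_real_between[a /andP[supa aP]].
have [f Df fP] := sep a aP.
move: supa; rewrite ltNge => /negP; apply.
apply: le_trans (ereal_sup_ubound _); last by exists f; [exact: Df|reflexivity].
apply: le_ereal_inf_tmp => _ [Q /= PQ <-].
by rewrite leNgt; apply/negP => /ltW/fP; rewrite ltNge PQ.
Qed.

Theorem proposition24 (R : realType) (Phi : borel_prob R -> \bar R)
    (Phi_gtNy : forall P : borel_prob R, (-oo < Phi P)%E)
    (Phi_lsc : @lower_semicontinuous (weak_prob R) R Phi)
    (Phi_qc : quasi_convex Phi) :
  (forall P : borel_prob R,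
      Phi P = ereal_sup [set inf_risk Phi (mean f P) f | f in @Cb R]) /\
  (stoch_monotone Phi ->
    forall P : borel_prob R,
      Phi P = ereal_sup [set inf_risk Phi (mean f P) f | f in @Cb_dec R]).
Proof.
split=> [P|mono P]; apply: dual_representation => a aP.
all: have [f Cf [g g0 fg]] := quasi_convex_lsc_separation Phi_lsc Phi_qc aP.
  by exists f => // Q /fg; apply: lt_le_trans; rewrite ltrDl.
exists (right_sup f).
  by split; [exact: Cb_right_sup|exact: right_sup_nonincreasing].
move=> Q Qa; have g20 : 0 < g / 2 by rewrite divr_gt0.
(* Transport costs half of the gap, and by monotonicity [Q'] stays in the sublevel set: [mean
   (right_sup f) Q <= mean f Q' + g / 2 <= mean f P - g / 2]. *)
have [Q' QQ' gQ'] := stoch_le_transport Q Cf g20.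
have := fg Q' (le_trans (mono _ _ QQ') Qa).
have : mean f P <= mean (right_sup f) P.
  by apply: le_mean => // [|x]; [exact: Cb_right_sup|exact: le_right_sup].
lra.
Qed.
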